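(* Fix $n\in\mathbb{Z}_{\ge1}$, $k\in\mathbb{Z}_{\ge0}$, and $d\mid n$. For $j\in[1,n/d]$ let $I_d^j=[(j-1)d,jd-1]$. For a weak composition $\alpha=(\alpha_1,\dots,\alpha_{n/d})$ of $k$, let $\mathcal{M}_\alpha$ be the set of $k$-element multisubsets $A$ of $[0,n-1]$ such that $A$ has exactly $\alpha_j$ elements (counted with multiplicity) in $I_d^j$ for every $j$. Let $C_d$ act on $[0,n-1]$ via the permutation $\sigma_d=(0\,1\,\cdots\,(d-1))((d)\,(d+1)\,\cdots\,(2d-1))\cdots((n-d)\,\cdots\,(n-1))$ (simultaneous rotation of all $I_d^j$), and elementwise on multisubsets. Then $(\mathcal{M}_\alpha,C_d,\mathcal{M}_\alpha^{\mathrm{Sum}}(q))$ exhibits the cyclic sieving phenomenon, and hence refines the CSP triple $(\mathcal{M},C_d,\mathcal{M}^{\mathrm{Sum}}(q))$ where $\mathcal{M}$ is the set of all $k$-element multisubsets of $[0,n-1]$.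
   Context: $[a,b]=\{i\in\mathbb{Z}:a\le i\le b\}$. $\mathrm{Sum}(A)$ is the sum of the elements of a multiset $A$ counted with multiplicity, and $X^{\mathrm{Sum}}(q)=\sum_{A\in X}q^{\mathrm{Sum}(A)}$. For a finite set $W$ acted on by a cyclic group $C=\langle\tau\rangle$ of order $r$ and $f(q)\in\mathbb{N}[q]$, $(W,C,f(q))$ exhibits the CSP if $\#\{x\in W:\tau^jx=x\}=f(\omega_r^j)$ for all $j\in\mathbb{Z}$, with $\omega_r$ a fixed primitive $r$-th root of unity. *)

(* Defs.v *)
From mathcomp Require Import all_boot all_order all_algebra all_fingroup all_solvable all_field.
From mathcomp Require Import finmap multiset.

Set Implicit Arguments.
Unset Strict Implicit.
Unset Printing Implicit Defensive.

Import GRing.Theory.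
Local Open Scope mset_scope.
Local Open Scope fset_scope.

Definition expgz (gT : finGroupType) (x : gT) (j : int) : gT :=
  match j with
  | Posz m => (x ^+ m)%g
  | Negz m => (x ^- m.+1)%g
  end.

Definition genpoly (T : choiceType) (stat : T -> nat) (W : {fset T}) :
    {poly nat} :=
  (\sum_(x <- W) 'X^(stat x))%R.

Definition eval_algC (f : {poly nat}) (z : algC) : algC :=
  ((map_poly (fun c : nat => c%:R : algC) f).[z])%R.

(* [T] need not be finite: the finite set acted on is [W], which is required
   to be stable under [C = <[tau]>], the action being the restriction of [to].
   The order [r] of [C] is [#[tau]]. *)
Definition exhibits_CSP (gT : finGroupType) (T : choiceType)
    (to : {action gT &-> T}) (tau : gT) (W : {fset T}) (f : {poly nat}) : Prop :=
  (forall g : gT, g \in <[tau]>%g -> forall x : T, x \in W -> to x g \in W) /\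
  (forall omega : algC, (#[tau]%g).-primitive_root%R omega ->
   forall j : int,
     ((#|` [fset x in W | to x (expgz tau j) == x]|)%:R)%R
     = eval_algC f (omega ^ j)%R).

(* The triple [(V, C, V^stat(q))] refines [(W, C, W^stat(q))]: both exhibit the
   CSP, and [V] is a subset of [W] with the restricted action and statistic. *)
Definition refines_CSP (gT : finGroupType) (T : choiceType)
    (to : {action gT &-> T}) (tau : gT) (stat : T -> nat) (V W : {fset T}) :
    Prop :=
  [/\ V `<=` W,
      exhibits_CSP to tau V (genpoly stat V)
    & exhibits_CSP to tau W (genpoly stat W)].

Section MsetAction.
Variable T : finType.

Definition mset_perm (A : {mset T}) (s : {perm T}) : {mset T} :=
  seq_mset [seq s x | x <- A].

Lemma mset_permE A s x : mset_perm A s (s x) = A x.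
Proof.
rewrite mset_seqE count_map -count_mem_mset; apply: eq_count => y /=.
by rewrite (inj_eq perm_inj).
Qed.

Lemma mset_perm1 A : mset_perm A 1%g = A.
Proof. by apply/msetP => x; rewrite -{1}[x](perm1 x) mset_permE. Qed.

Lemma mset_permM A : act_morph mset_perm A.
Proof.
move=> s t; apply/msetP => x.
have -> : x = (s * t)%g ((s * t)^-1%g x) by rewrite permKV.
by rewrite mset_permE permM !mset_permE.
Qed.

Definition mset_action : {action {perm T} &-> {mset T}} :=
  TotalAction mset_perm1 mset_permM.

End MsetAction.

Definition multisubsets (n k : nat) : {fset {mset 'I_n}} :=
  [fset seq_mset (val t) | t in {: k.-tuple 'I_n}].

Lemma in_multisubsets n k (A : {mset 'I_n}) :
  (A \in multisubsets n k) = (size A == k).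
Proof.
apply/imfsetP/eqP => [[t _ ->] | sA].
  by rewrite (perm_size (perm_eq_seq_mset _)) size_tuple.
by exists (Tuple (introT eqP sA)); rewrite //= seq_mset_id.
Qed.

Definition msum (n : nat) (A : {mset 'I_n}) : nat := \sum_(i <- A) (i : nat).

(* Blocks are indexed from 0: [block j] is [j d, (j+1) d - 1], that is I_d^(j+1). *)
Definition block (n d : nat) (j : 'I_(n %/ d)) : {set 'I_n} :=
  [set i : 'I_n | j * d <= i <= (j.+1 * d).-1].

Definition has_content (n d : nat) (alpha : 'I_(n %/ d) -> nat)
    (A : {mset 'I_n}) : bool :=
  [forall j : 'I_(n %/ d), count (mem (block j)) A == alpha j].

Definition multisubsets_comp (n k d : nat) (alpha : 'I_(n %/ d) -> nat) :
    {fset {mset 'I_n}} :=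
  [fset A in multisubsets n k | has_content alpha A].

Lemma in_multisubsets_comp n k d (alpha : 'I_(n %/ d) -> nat)
    (A : {mset 'I_n}) :
  (A \in multisubsets_comp k alpha) = (size A == k) && has_content alpha A.
Proof. by rewrite !inE /= in_multisubsets. Qed.

Section Rotation.
Variables (n d : nat) (dn : d %| n).

Lemma block_rot_subproof (e : nat) (i : 'I_n) :
  i %/ d * d + (i %% d + e) %% d < n.
Proof.
have n_gt0 : 0 < n by apply: leq_ltn_trans (ltn_ord i).
have d_gt0 : 0 < d by apply: dvdn_gt0 dn.
apply: (@leq_trans ((i %/ d).+1 * d)).
  by rewrite mulSn addnC ltn_add2r ltn_mod.
by rewrite -{2}(divnK dn) leq_mul2r ltn_divRL ?(leq_ltn_trans (leq_divM _ _)) ?orbT.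
Qed.

Definition block_rot (e : nat) (i : 'I_n) : 'I_n :=
  Ordinal (block_rot_subproof e i).

Lemma block_rotD e e' i : block_rot e (block_rot e' i) = block_rot (e' + e) i.
Proof.
have n_gt0 : 0 < n by apply: leq_ltn_trans (ltn_ord i).
have d_gt0 : 0 < d by apply: dvdn_gt0 dn.
apply: val_inj => /=.
by rewrite divnMDl // [_ %% d %/ d]divn_small ?ltn_mod // addn0 modnMDl modn_mod modnDml addnA.
Qed.

Lemma block_rot0 e i : d %| e -> block_rot e i = i.
Proof.
move=> de; apply: val_inj => /=.
by rewrite -modnDmr (eqP de) addn0 modn_mod -divn_eq.
Qed.

Lemma block_rot_inj : injective (block_rot 1).
Proof.
move=> i j /(congr1 (block_rot d.-1)); rewrite !block_rotD.
have n_gt0 : 0 < n by apply: leq_ltn_trans (ltn_ord i).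
by rewrite add1n prednK ?(dvdn_gt0 n_gt0 dn) // !block_rot0.
Qed.

(* sigma_d sends [i = q * d + s], with [s < d], to [q * d + (s + 1) %% d]. *)
Definition sigma : {perm 'I_n} := perm block_rot_inj.

Lemma sigmaX e i : (sigma ^+ e)%g i = block_rot e i.
Proof.
elim: e => [|e IHe]; first by rewrite perm1 block_rot0.
by rewrite expgSr permM IHe permE block_rotD addn1.
Qed.

(* So <[sigma]> is cyclic of order d, and the omega in [exhibits_CSP] is a
   primitive d-th root of unity. *)
Lemma order_sigma : 0 < n -> #[sigma]%g = d.
Proof.
move=> n_gt0; apply/eqP; rewrite eqn_dvd order_dvdn; apply/andP; split.
  by apply/eqP/permP => i; rewrite sigmaX perm1 block_rot0.
have /permP/(_ (Ordinal n_gt0)) := expg_order sigma.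
by rewrite sigmaX perm1 => /(congr1 val) /=; rewrite div0n mod0n add0n => /eqP.
Qed.

End Rotation.

(* Main.v *)
(* Put z = omega ^ e, a primitive m-th root of unity with m = d / g and
   g = gcd(e, d).  A multiset of content alpha is a family of multiplicity
   functions b : 'I_d -> nat, one for each block j, with sum alpha j; the block
   offsets do not affect z ^ Sum since z ^ d = 1, and the action of sigma ^ e
   is componentwise.  So both sides are products over the blocks, and it is
   enough to treat one block.  There, z ^ Sum is counted by the coefficients of
   the product over s < d of 1 / (1 - z ^ s X), which is 1 / (1 - X ^ m) ^ g
   because the d factors form g copies of the factorisation of 1 - X ^ m.
   The same series counts the invariant b, which are the functions of s mod g.
   The power series are truncated modulo X ^ K.  The claim for all k-element
   multisets follows by summing over alpha. *)

Require Import Defs.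
From mathcomp Require Import all_boot all_order all_algebra all_fingroup all_field.
From mathcomp Require Import finmap multiset.

Set Implicit Arguments.
Unset Strict Implicit.
Unset Printing Implicit Defensive.

Import GRing.Theory.

(** * Products over the powers of a primitive root of unity, modulo ['X^K] *)

Section PrimitiveRootProduct.
Variable F : fieldType.
Local Open Scope ring_scope.

(** This is the factorisation of ['X^m - 1] over the powers of [z^-1], with the unit [- z^-s] pulled
    out of each factor. *)
Lemma prod_prim_root_sub1 (m : nat) (z : F) : m.-primitive_root z ->
  \prod_(0 <= s < m) (1 - z ^+ s *: 'X) = 1 - 'X^m :> {poly F}.
Proof.
move=> prz; have m_gt0 := prim_order_gt0 prz.
have z_neq0 : z != 0 by rewrite (prim_root_eq0 prz) -lt0n.
have przV : m.-primitive_root z^-1.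
  have -> : z^-1 = z ^+ m.-1.
    apply: (mulfI z_neq0); rewrite mulfV // -exprS prednK //.
    by rewrite (prim_expr_order prz).
  by rewrite (prim_root_exp_coprime _ prz) -{2}(prednK m_gt0) coprimenS.
have E := factor_Xn_sub_1 przV.
have EX s : 'X - (z^-1 ^+ s)%:P = - (z^-1 ^+ s)%:P * (1 - z ^+ s *: 'X).
  rewrite mulrBr mulr1 mulNr opprK addrC -mul_polyC mulrA -polyCM -exprMn.
  by rewrite mulVf // expr1n polyC1 mul1r.
rewrite (eq_bigr _ (fun s _ => EX s)) big_split /= in E.
(* The product of the units is the value at 0 of the same factorisation; [0 ^+ m] vanishes because
   [m > 0]. *)
have E0 : \prod_(0 <= s < m) (- (z^-1 ^+ s)%:P) = - 1 :> {poly F}.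
  have /(congr1 (fun p => p.[0])) := factor_Xn_sub_1 przV.
  rewrite horner_prod hornerD hornerN hornerXn hornerC expr0n eqn0Ngt m_gt0 sub0r.
  move/(congr1 polyC); rewrite polyCN polyC1 rmorph_prod => <-.
  by apply: eq_bigr => s _; rewrite hornerXsubC sub0r -polyCN.
by rewrite E0 mulN1r in E; rewrite -[LHS]opprK E opprB.
Qed.

(** The product telescopes to [1 - ('X * p) ^+ K]; the factor ['X] in the ratio is what makes the
    remainder divisible by ['X^K]. *)
Lemma geom_sum_modXn (p : {poly F}) (K : nat) :
  ((1 - 'X * p) * \sum_(a < K) ('X * p) ^+ a) %% 'X^K = 1 %% 'X^K.
Proof.
have -> : (1 - 'X * p) * \sum_(a < K) ('X * p) ^+ a = 1 + 'X^K * (- p ^+ K).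
  by rewrite -[1 - _]opprB mulNr -subrX1 opprB exprMn mulrN.
by rewrite modpD modp_mulr addr0.
Qed.

Lemma prod_modp_eq1 (I : Type) (r : seq I) (f h : I -> {poly F}) (q : {poly F}) :
  (forall i, (f i * h i) %% q = 1 %% q) ->
  ((\prod_(i <- r) f i) * (\prod_(i <- r) h i)) %% q = 1 %% q.
Proof.
move=> fh; rewrite -big_split /=; elim: r => [|i r IHr]; first by rewrite big_nil.
by rewrite big_cons -modp_mul IHr modp_mul mulr1 fh.
Qed.

(** Reduce [D * P * Q] in two ways. Truncated series are thus compared through a common inverse. *)
Lemma modp_inv_uniq (D P Q q : {poly F}) :
  (D * P) %% q = 1 %% q -> (D * Q) %% q = 1 %% q -> P %% q = Q %% q.
Proof.
move=> DP DQ; transitivity ((D * P * Q) %% q).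
  by rewrite [D * P]mulrC -mulrA -modp_mul DQ modp_mul mulr1.
by rewrite mulrC -modp_mul DP modp_mul mulr1.
Qed.

Lemma coef_modXn (p : {poly F}) (K i : nat) : (i < K)%N -> (p %% 'X^K)`_i = p`_i.
Proof.
by move=> iK; rewrite [p in RHS](divp_eq p 'X^K) coefD coefMXn iK add0r.
Qed.

(* Both products are the inverse of [(1 - 'X^m) ^+ g] modulo ['X^K]. *)
Lemma prod_geom_prim_root (m g K : nat) (z : F) : m.-primitive_root z ->
  (\prod_(s < g * m) \sum_(a < K) (z ^+ s) ^+ a *: 'X^(1 * a)) %% 'X^K
  = (\prod_(t < g) \sum_(a < K) 1 *: 'X^(m * a)) %% 'X^K.
Proof.
move=> prz; have m_gt0 := prim_order_gt0 prz.
have DE :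
    \prod_(s < g * m) (1 - z ^+ s *: 'X) = \prod_(t < g) (1 - 'X^m) :> {poly F}.
  rewrite -(big_mkord xpredT (fun s => 1 - z ^+ s *: 'X)) big_nat_mul big_mkord.
  apply: eq_bigr => t _; rewrite -(prod_prim_root_sub1 prz).
  rewrite mulSn -{1}[(t * m)%N]add0n big_addn addnK; apply: eq_bigr => s _.
  by rewrite exprD mulnC exprM (prim_expr_order prz) expr1n mulr1.
apply: (@modp_inv_uniq (\prod_(t < g) (1 - 'X^m))).
  rewrite -DE; apply: prod_modp_eq1 => s; rewrite -(geom_sum_modXn (z ^+ s)%:P).
  congr ((_ * _) %% _); first by rewrite mulrC mul_polyC.
  apply: eq_bigr => a _.
  by rewrite mul1n exprMn -polyC_exp mulrC mul_polyC.
(* The ratio ['X^m] is written as ['X * 'X^(m.-1)] to fit the geometric sum. *)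
apply: prod_modp_eq1 => t; rewrite -(geom_sum_modXn 'X^(m.-1)) -exprS prednK //.
by congr ((_ * _) %% _); apply: eq_bigr => a _; rewrite scale1r exprM.
Qed.

(** Expanding the product, each choice [b] of exponents gives one monomial. The step [u] is 1 for
    arbitrary functions and [m] for invariant ones. *)
Lemma coef_prod_sum_ffun (I : finType) (K u al : nat) (w : I -> nat -> F) :
  (\prod_(i : I) \sum_(a < K) w i a *: 'X^(u * a))`_al
  = \sum_(b : {ffun I -> 'I_K} | (u * \sum_i b i)%N == al) \prod_i w i (b i).
Proof.
rewrite bigA_distr_bigA coef_sum [RHS]big_mkcond; apply: eq_bigr => b _.
rewrite scaler_prod -expr_sum -big_distrr /= coefZ coefXn eq_sym.
by case: eqP; rewrite ?mulr1 ?mulr0.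
Qed.

(** * Functions on a single block and their invariance under a cyclic shift *)

Definition cyc_invariant (d K e : nat) (b : {ffun 'I_d -> 'I_K}) : bool :=
  [forall s : 'I_d, forall t : 'I_d, (t == (s + e) %% d :> nat)%N ==> (b t == b s)].

(** Modulo [d], the multiples of [e] are exactly the multiples of [gcdn e d]. *)
Lemma cyc_invariantP (d K e : nat) (b : {ffun 'I_d -> 'I_K}) :
  reflect (forall s t : 'I_d, (s = t %[mod gcdn e d])%N -> b s = b t)
          (cyc_invariant e b).
Proof.
case: d b => [|d] b.
  by apply: (iffP idP) => [_ []|_] //; apply/forallP; case.
apply: (iffP idP) => [inv_b | inv_b]; last first.
  apply/forallP => s; apply/forallP => t; apply/implyP => /eqP ts.
  apply/eqP/inv_b; rewrite ts modn_dvdm ?dvdn_gcdr //.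
  by rewrite -modnDmr (eqP (dvdn_gcdl _ _)) addn0.
have shift u (s t : 'I_d.+1) : (t = (s + u * e) %% d.+1 :> nat)%N -> b t = b s.
  elim: u t => [|u IHu] t ts.
    by congr (b _); apply: val_inj; rewrite /= ts addn0 modn_small.
  rewrite -(IHu (inord ((s + u * e) %% d.+1))) ?inordK ?ltn_pmod //.
  have /forallP/(_ (inord ((s + u * e) %% d.+1)))/forallP/(_ t)/implyP := inv_b.
  move=> inv_bt; apply/eqP/inv_bt.
  by rewrite inordK ?ltn_pmod // modnDml -addnA -mulSnr ts.
move=> s t st.
have [a _ /dvdnP[c Ec]] := Bezoutr e (ltn0Sn d).
have red (x : 'I_d.+1) : b x = b (inord (x %% gcdn e d.+1)).
  set g := gcdn e d.+1 in Ec *.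
  (* By Bezout [g + a * e = c * d.+1], so [a] shifts by [e] amount to one shift by [-g]; repeating
     this [x %/ g] times brings [x] down to [x %% g]. *)
  apply/esym/(shift (x %/ g * a)%N).
  rewrite inordK; last exact: leq_ltn_trans (leq_mod _ _) (ltn_ord x).
  have -> : (x + x %/ g * a * e = x %% g + x %/ g * c * d.+1)%N.
    by rewrite -!mulnA -Ec mulnDr addnA [(_ %% _ + _)%N]addnC -divn_eq.
  rewrite addnC modnMDl [RHS]modn_small //.
  exact: leq_ltn_trans (leq_mod _ _) (ltn_ord x).
by rewrite red st -red.
Qed.

(** An invariant function is the [m]-fold periodic repetition of its restriction to the first [g]
    points, so its sum is [m] times that of the restriction. *)
Lemma card_cyc_invariant (m g K e al : nat) : (gcdn e (g * m) = g)%N -> (0 < g)%N ->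
  (0 < m)%N ->
  \sum_(b : {ffun 'I_(g * m) -> 'I_K} | (\sum_i b i)%N == al)
     (cyc_invariant e b)%:R
  = \sum_(c : {ffun 'I_g -> 'I_K} | (m * \sum_i c i)%N == al) 1 :> F.
Proof.
move=> gE g_gt0 m_gt0.
have mod_lt s : (s %% g < g)%N by rewrite ltn_mod.
have g_le : (g <= g * m)%N by rewrite leq_pmulr.
pose ext (c : {ffun 'I_g -> 'I_K}) :=
  [ffun s : 'I_(g * m) => c (Ordinal (mod_lt s))].
pose res (b : {ffun 'I_(g * m) -> 'I_K}) := [ffun t : 'I_g => b (widen_ord g_le t)].
rewrite (eq_bigr _ (fun b _ => mulrb _ _)) -big_mkcondr /=.
rewrite (reindex_onto ext res) /=; last first.
  move=> b /andP[_ /cyc_invariantP inv_b]; apply/ffunP => s; rewrite !ffunE.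
  by apply: inv_b; rewrite gE /= modn_mod.
apply: eq_bigl => c.
have -> : res (ext c) == c.
  apply/eqP/ffunP => t; rewrite !ffunE; congr (c _).
  by apply: val_inj; rewrite /= modn_small.
have -> : cyc_invariant e (ext c).
  apply/cyc_invariantP => s t; rewrite gE => st; rewrite !ffunE.
  by congr (c _); apply: val_inj.
rewrite !andbT; congr (_ == _).
(* Extending periodically to all of [nat] allows the range to be cut into [m] runs of length [g]. *)
pose f s := c (Ordinal (mod_lt s)) : nat.
transitivity (\sum_(0 <= s < m * g) f s)%N.
  by rewrite [(m * g)%N]mulnC big_mkord; apply: eq_bigr => s _; rewrite ffunE.
rewrite -[in RHS](card_ord m) -sum_nat_const big_nat_mul big_mkord.
apply: eq_bigr => t _; rewrite mulSn -{1}[(t * g)%N]add0n big_addn addnK big_mkord.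
apply: eq_bigr => s _; rewrite /f; congr (nat_of_ord (c _)).
by apply: val_inj; rewrite /= addnC modnMDl modn_small.
Qed.

(** Both sides are coefficients of degree [al] in the two products of [prod_geom_prim_root];
    truncation does no harm since [al < K]. *)
Lemma block_csp (d e K al : nat) (omega : F) :
  d.-primitive_root omega -> (al < K)%N ->
  \sum_(b : {ffun 'I_d -> 'I_K} | (\sum_i b i)%N == al)
     \prod_(s < d) ((omega ^+ e) ^+ s) ^+ b s
  = \sum_(b : {ffun 'I_d -> 'I_K} | (\sum_i b i)%N == al) (cyc_invariant e b)%:R.
Proof.
move=> pro alK; have d_gt0 := prim_order_gt0 pro.
have := exp_prim_root pro e; set z := omega ^+ e; set g := gcdn e d => prz.
have g_gt0 : (0 < g)%N by rewrite gcdn_gt0 d_gt0 orbT.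
have dE : d = (g * (d %/ g))%N by rewrite mulnC divnK ?dvdn_gcdr.
have m_gt0 := prim_order_gt0 prz.
move: (d %/ g)%N m_gt0 dE prz => m m_gt0 dE prz.
have gE : gcdn e (g * m) = g by rewrite -dE.
rewrite {}dE in d_gt0 *; clearbody g.
rewrite (card_cyc_invariant _ _ gE) //.
transitivity ((\prod_(s < g * m) \sum_(a < K) (z ^+ s) ^+ a *: 'X^(1 * a))`_al).
  rewrite (coef_prod_sum_ffun _ _ _ (fun s a => (z ^+ (s : 'I__)) ^+ a)).
  by apply: eq_bigl => b; rewrite mul1n.
rewrite -(coef_modXn _ alK) prod_geom_prim_root // coef_modXn //.
rewrite (coef_prod_sum_ffun _ _ _ (fun _ _ => 1)).
by apply: eq_bigr => c _; rewrite big1.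
Qed.

End PrimitiveRootProduct.

(** * Multisets as multiplicity functions, and sieving with natural exponents *)

Section Multisets.
Local Open Scope mset_scope.
Local Open Scope fset_scope.

Lemma natr_forall (R : comPzSemiRingType) (I : finType) (P : pred I) :
  ([forall i, P i]%:R = \prod_i (P i)%:R :> R)%R.
Proof.
have [/forallP allP | /forallPn[i nPi]] := boolP [forall i, P i].
  by rewrite big1 // => i _; rewrite allP.
by rewrite (bigD1 i) //= (negPf nPi) mul0r.
Qed.

Lemma sum_multiset (T : finType) (F : T -> nat) (A : {mset T}) :
  \sum_(x <- A) F x = \sum_x A x * F x.
Proof.
rewrite (partition_big id xpredT) //=; apply: eq_bigr => x _.
rewrite (eq_bigr (fun=> F x)); last by move=> y /eqP ->.
by rewrite big_const_seq iter_addn_0 mulnC; congr (_ * _); apply: count_mem_mset.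
Qed.

Lemma count_multiset (T : finType) (P : pred T) (A : {mset T}) :
  count P A = \sum_(x | P x) A x.
Proof.
rewrite -sum1_count big_mkcond sum_multiset [RHS]big_mkcond /=.
by apply: eq_bigr => x _; case: (P x); rewrite ?muln1 ?muln0.
Qed.

Lemma size_multiset (T : finType) (A : {mset T}) : size A = \sum_x A x.
Proof. by rewrite -count_predT count_multiset. Qed.

Definition mset_fun (T : finType) (f : T -> nat) : {mset T} :=
  [fsfun x in [fset x in enum T] => f x].

Lemma mset_funE (T : finType) (f : T -> nat) x : mset_fun f x = f x.
Proof. by rewrite fsfunE !inE /= mem_enum. Qed.

Lemma mset_perm_fixP (T : finType) (A : {mset T}) (s : {perm T}) :
  reflect (forall x, A (s x) = A x) (mset_perm A s == A).
Proof.
apply: (iffP eqP) => [As x | As]; first by rewrite -{1}As mset_permE.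
by apply/msetP => x; rewrite -[x](permKV s) mset_permE As.
Qed.

(** With [r] the order of [tau], both [tau] and [omega] have [r]-th power 1, so the exponent
    [-(m + 1)] can be replaced by [(r - 1) * (m + 1)]. *)
Lemma exhibits_CSP_nat (gT : finGroupType) (T : choiceType)
    (to : {action gT &-> T}) (tau : gT) (W : {fset T}) (stat : T -> nat) :
  (forall g : gT, g \in <[tau]>%g -> forall x : T, x \in W -> to x g \in W) ->
  (forall omega : algC, (#[tau]%g).-primitive_root%R omega ->
   forall e : nat,
     (\sum_(x <- W) (to x (tau ^+ e)%g == x)%:R
      = \sum_(x <- W) (omega ^+ e) ^+ stat x)%R) ->
  exhibits_CSP to tau W (genpoly stat W).
Proof.
move=> stab csp; split=> // omega pro j.
have o_gt0 : 0 < #[tau]%g by apply: order_gt0.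
have o_neq0 : omega != 0%R by rewrite (prim_root_eq0 pro) -lt0n.
have [e -> ->] : exists2 e, expgz tau j = (tau ^+ e)%g &
    (omega ^ j)%R = (omega ^+ e)%R.
  case: j => m; first by exists m.
  exists (#[tau]%g.-1 * m.+1) => /=; first by rewrite -expgVn invg_expg expgM.
  rewrite NegzE -exprnN -exprVn exprM; congr (_ ^+ _)%R.
  by apply: (mulfI o_neq0); rewrite mulfV // -exprS prednK // (prim_expr_order pro).
transitivity (\sum_(x <- W) (to x (tau ^+ e)%g == x)%:R : algC)%R.
  rewrite -natr_sum card_fset_sum1 -big_fset_condE big_mkcond /=.
  by congr (_%:R)%R; apply: eq_bigr => x _; case: eqP.
rewrite (csp _ pro) /eval_algC /genpoly.
rewrite (raddf_sum (map_poly (GRing.natmul 1%R))) horner_sum /=.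
by apply: eq_bigr => x _; rewrite map_polyXn hornerXn.
Qed.

End Multisets.

(** * Decomposition of multisets along the blocks *)

Section Blocks.
Local Open Scope mset_scope.
Local Open Scope fset_scope.
Variables (n d : nat) (dn : d %| n).

Lemma block_ord_subproof (j : 'I_(n %/ d)) (s : 'I_d) : j * d + s < n.
Proof.
apply: (@leq_trans (j.+1 * d)); first by rewrite mulSn addnC ltn_add2r.
by rewrite -{2}(divnK dn) leq_mul2r ltn_ord orbT.
Qed.

Definition block_ord j s : 'I_n := Ordinal (block_ord_subproof j s).

Lemma block_ord_gt0 (i : 'I_n) : 0 < d.
Proof. by apply: dvdn_gt0 dn; apply: leq_ltn_trans (ltn_ord i). Qed.

Lemma block_quo_subproof (i : 'I_n) : i %/ d < n %/ d.
Proof. by rewrite ltn_divRL // (leq_ltn_trans (leq_divM _ _)). Qed.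

Lemma block_rem_subproof (i : 'I_n) : i %% d < d.
Proof. by rewrite ltn_mod (block_ord_gt0 i). Qed.

Definition block_quo i : 'I_(n %/ d) := Ordinal (block_quo_subproof i).
Definition block_rem i : 'I_d := Ordinal (block_rem_subproof i).

Lemma block_ordK i : block_ord (block_quo i) (block_rem i) = i.
Proof. by apply: val_inj; rewrite /= -divn_eq. Qed.

Lemma block_quoK j s : block_quo (block_ord j s) = j.
Proof.
apply: val_inj => /=; have d_gt0 := leq_ltn_trans (leq0n s) (ltn_ord s).
by rewrite divnMDl // [s %/ d]divn_small ?addn0.
Qed.

Lemma block_remK j s : block_rem (block_ord j s) = s.
Proof. by apply: val_inj; rewrite /= modnMDl modn_small. Qed.

Lemma in_block (j : 'I_(n %/ d)) (i : 'I_n) : (i \in block j) = (block_quo i == j).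
Proof.
have d_gt0 := block_ord_gt0 i.
(* Since [d > 0], the closed bound [(j.+1 * d).-1] becomes the strict bound [j.+1 * d]. *)
rewrite inE -val_eqE -[X in _ && X]ltnS prednK ?muln_gt0 //=.
by rewrite -ltn_divLR // -leq_divRL // ltnS andbC -eqn_leq.
Qed.

Lemma sum_block_ord (F : 'I_n -> nat) :
  \sum_i F i = \sum_j \sum_s F (block_ord j s).
Proof.
rewrite pair_bigA /= (reindex (fun p => block_ord p.1 p.2)) //=.
exists (fun i => (block_quo i, block_rem i)) => [[j s]|i] _ /=.
  by rewrite block_quoK block_remK.
exact: block_ordK.
Qed.

Lemma count_block (A : {mset 'I_n}) j :
  count (mem (block j)) A = \sum_s A (block_ord j s).
Proof.
rewrite count_multiset big_mkcond sum_block_ord.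
rewrite -[RHS](big_pred1_eq addn j (fun j => \sum_s A (block_ord j s))).
rewrite [RHS]big_mkcond; apply: eq_bigr => j' _; have [-> | j'j] := eqVneq j' j.
  by apply: eq_bigr => s _; rewrite /= in_block block_quoK eqxx.
by apply: big1 => s _; rewrite /= in_block block_quoK (negPf j'j).
Qed.

Lemma size_blocks (A : {mset 'I_n}) :
  size A = \sum_(j < n %/ d) count (mem (block j)) A.
Proof.
rewrite size_multiset sum_block_ord.
by apply: eq_bigr => j _; rewrite count_block.
Qed.

Lemma mem_multisubsets_comp k (alpha : 'I_(n %/ d) -> nat) (A : {mset 'I_n}) :
  \sum_j alpha j = k ->
  (A \in multisubsets_comp k alpha) = has_content alpha A.
Proof.
move=> sum_alpha; rewrite in_multisubsets_comp andbC.
have [/forallP cA /=|//] := boolP (has_content alpha A).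
by rewrite size_blocks -sum_alpha; apply/eqP/eq_bigr => j _; apply/eqP.
Qed.

Definition mset_of_blocks K (a : {ffun 'I_(n %/ d) -> {ffun 'I_d -> 'I_K}}) :
    {mset 'I_n} :=
  mset_fun (fun i => a (block_quo i) (block_rem i)).

Lemma mset_of_blocksE K (a : {ffun 'I_(n %/ d) -> {ffun 'I_d -> 'I_K}}) j s :
  mset_of_blocks a (block_ord j s) = a j s.
Proof. by rewrite mset_funE block_quoK block_remK. Qed.

(** Multiplicities are at most the size [k], so values in ['I_k.+1] suffice. The index set becomes a
    product over the blocks, ready for distributivity. *)
Lemma big_multisubsets_comp (R : Type) (idx : R) (op : Monoid.com_law idx) k
    (alpha : 'I_(n %/ d) -> nat) (G : {mset 'I_n} -> R) :
  \sum_j alpha j = k ->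
  \big[op/idx]_(A <- multisubsets_comp k alpha) G A =
  \big[op/idx]_(a in family (fun j =>
      [pred b : {ffun 'I_d -> 'I_k.+1} | \sum_s b s == alpha j]))
    G (mset_of_blocks a).
Proof.
move=> sum_alpha; set Q := family _.
rewrite -big_enum /= -(big_map (@mset_of_blocks k.+1) xpredT G).
apply: perm_big; apply: uniq_perm; first exact: fset_uniq.
  rewrite map_inj_uniq ?enum_uniq // => a a' aa'.
  apply/ffunP => j; apply/ffunP => s; apply: val_inj.
  by rewrite /= -!mset_of_blocksE aa'.
move=> A; rewrite mem_multisubsets_comp //; apply/idP/mapP.
  move=> cA; have: A \in multisubsets_comp k alpha by rewrite mem_multisubsets_comp.
  rewrite in_multisubsets_comp => /andP[/eqP szA _].
  have AK i : A i < k.+1 by rewrite ltnS -szA -count_mem_mset count_size.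
  exists [ffun j => [ffun s => inord (A (block_ord j s))]].
    rewrite mem_enum; apply/familyP => j; rewrite ffunE inE.
    move/forallP/(_ j): cA; rewrite count_block; congr (_ == _).
    by apply: eq_bigr => s _; rewrite ffunE inordK.
  by apply/msetP => i; rewrite mset_funE !ffunE inordK // block_ordK.
move=> [a]; rewrite mem_enum => /familyP aQ ->; apply/forallP => j.
rewrite count_block; have := aQ j; rewrite inE; congr (_ == _).
by apply: eq_bigr => s _; rewrite mset_of_blocksE.
Qed.

Lemma sigmaX_block_ord e j (s t : 'I_d) : t = (s + e) %% d :> nat ->
  (sigma dn ^+ e)%g (block_ord j s) = block_ord j t.
Proof.
move=> ts; rewrite sigmaX; apply: val_inj => /=.
have d_gt0 := leq_ltn_trans (leq0n s) (ltn_ord s).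
by rewrite divnMDl // [s %/ d]divn_small // addn0 modnMDl modnDml ts.
Qed.

Lemma sigmaX_block_quo e i : block_quo ((sigma dn ^+ e)%g i) = block_quo i.
Proof.
rewrite -{1}[i]block_ordK.
pose t := Ordinal (ltn_pmod (block_rem i + e) (block_ord_gt0 i)).
rewrite (@sigmaX_block_ord _ _ _ t) //.
exact: block_quoK.
Qed.

(** [sigma ^ e] keeps every block and shifts the offset by [e] modulo [d], so the condition splits
    blockwise. *)
Lemma mset_of_blocks_fix K e (a : {ffun 'I_(n %/ d) -> {ffun 'I_d -> 'I_K}}) :
  (mset_perm (mset_of_blocks a) (sigma dn ^+ e)%g == mset_of_blocks a)
  = [forall j, cyc_invariant e (a j)].
Proof.
apply/mset_perm_fixP/forallP => [fix_a j | inv_a i].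
  apply/forallP => s; apply/forallP => t; apply/implyP => /eqP ts.
  have := fix_a (block_ord j s).
  by rewrite (sigmaX_block_ord _ ts) !mset_of_blocksE => /val_inj ->.
pose t := Ordinal (ltn_pmod (block_rem i + e) (block_ord_gt0 i)).
rewrite -[i]block_ordK (@sigmaX_block_ord _ _ _ t) // !mset_of_blocksE.
have /forallP/(_ (block_rem i))/forallP/(_ t)/implyP := inv_a (block_quo i).
by move/(_ (eqxx _))/eqP ->.
Qed.

Lemma expr_msum_blocks (R : comPzRingType) K (z : R)
    (a : {ffun 'I_(n %/ d) -> {ffun 'I_d -> 'I_K}}) :
  (z ^+ d = 1 ->
   z ^+ msum (mset_of_blocks a) = \prod_j \prod_(s < d) (z ^+ s) ^+ a j s)%R.
Proof.
move=> zd; rewrite /msum sum_multiset sum_block_ord expr_sum.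
apply: eq_bigr => j _; rewrite expr_sum; apply: eq_bigr => s _.
rewrite mset_of_blocksE /= mulnC exprM exprD.
by rewrite mulnC exprM zd expr1n mul1r.
Qed.

Lemma csp_multisubsets_comp k e (alpha : 'I_(n %/ d) -> nat) (omega : algC) :
  \sum_j alpha j = k -> d.-primitive_root%R omega ->
  (\sum_(A <- multisubsets_comp k alpha)
      (mset_perm A (sigma dn ^+ e)%g == A)%:R
   = \sum_(A <- multisubsets_comp k alpha) (omega ^+ e) ^+ msum A)%R.
Proof.
move=> sum_alpha pro; rewrite !big_multisubsets_comp //.
under eq_bigr => a _ do rewrite mset_of_blocks_fix natr_forall.
under [RHS]eq_bigr => a _.
  rewrite expr_msum_blocks; last by rewrite exprAC (prim_expr_order pro) expr1n.
  over.
pose Q j := [pred b : {ffun 'I_d -> 'I_k.+1} | \sum_s b s == alpha j].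
(* Both summands are products over the blocks, so each sum over families is a product of sums over
   single blocks. *)
rewrite -(bigA_distr_big_dep Q (fun _ b => (cyc_invariant e b)%:R%R)).
rewrite -(bigA_distr_big_dep Q
  (fun _ b => (\prod_(s < d) ((omega ^+ e) ^+ s) ^+ b s)%R)).
(* The bound required by [block_csp] is [alpha j < k.+1], as [alpha j] is one term of a sum equal to
   [k]. *)
apply: eq_bigr => j _ /=; rewrite -(block_csp _ pro) // ltnS -sum_alpha.
by rewrite (bigD1 j) //= leq_addr.
Qed.

(** * Stability under the rotation, and summation over all contents *)

Lemma count_block_sigma (g : {perm 'I_n}) (A : {mset 'I_n}) (j : 'I_(n %/ d)) :
  g \in <[sigma dn]>%g ->
  count (mem (block j)) (mset_perm A g) = count (mem (block j)) A.
Proof.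
case/cycleP => e ->; rewrite (seq.permP (perm_eq_seq_mset _)) count_map.
by apply: eq_count => i; rewrite /= !in_block sigmaX_block_quo.
Qed.

Lemma sum_multisubsets (V : nmodType) k (G : {mset 'I_n} -> V) :
  (\sum_(A <- multisubsets n k) G A
   = \sum_(alpha : {ffun 'I_(n %/ d) -> 'I_k.+1} | (\sum_j alpha j == k)%N)
      \sum_(A <- multisubsets_comp k (fun j : 'I_(n %/ d) => alpha j)) G A)%R.
Proof.
(* The default value of [inord] never occurs on multisets of size [k], since block counts are at
   most [k]. *)
pose content (A : {mset 'I_n}) : {ffun 'I_(n %/ d) -> 'I_k.+1} :=
  [ffun j : 'I_(n %/ d) => inord (count (mem (block j)) A)].
have contentE (A : {mset 'I_n}) : A \in multisubsets n k ->
    forall j : 'I_(n %/ d), content A j = count (mem (block j)) A :> nat.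
  rewrite in_multisubsets => /eqP szA j.
  by rewrite ffunE inordK // ltnS -szA count_size.
rewrite big_seq (partition_big content (fun alpha => \sum_j alpha j == k)) /=.
  apply: eq_bigr => alpha _; rewrite -big_filter; apply: perm_big; apply: uniq_perm.
  - by rewrite filter_uniq // fset_uniq.
  - exact: fset_uniq.
  move=> A; rewrite mem_filter in_multisubsets_comp -in_multisubsets.
  have [Ak /=|//] := boolP (A \in multisubsets n k); rewrite ?andbF ?andbT //.
  apply/eqP/forallP => [<- j | cA]; first by rewrite contentE.
  by apply/ffunP => j; apply: val_inj; rewrite /= contentE //; apply/eqP.
move=> A Ak; rewrite (eq_bigr _ (fun j _ => contentE A Ak j)) -size_blocks.
by rewrite -in_multisubsets.
Qed.

Lemma csp_multisubsets k e (omega : algC) : d.-primitive_root%R omega ->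
  (\sum_(A <- multisubsets n k) (mset_perm A (sigma dn ^+ e)%g == A)%:R
   = \sum_(A <- multisubsets n k) (omega ^+ e) ^+ msum A)%R.
Proof.
move=> pro; rewrite !sum_multisubsets; apply: eq_bigr => alpha /eqP sum_alpha.
exact: csp_multisubsets_comp.
Qed.

End Blocks.

Theorem theorem7p4 (n k d : nat) (hn : 1 <= n) (dn : d %| n)
    (alpha : 'I_(n %/ d) -> nat)
    (halpha : \sum_(j < n %/ d) alpha j = k) :
  exhibits_CSP (mset_action 'I_n) (sigma dn)
    (multisubsets_comp k alpha)
    (genpoly (@msum n) (multisubsets_comp k alpha))
  /\ refines_CSP (mset_action 'I_n) (sigma dn) (@msum n)
       (multisubsets_comp k alpha) (multisubsets n k).
Proof.
have csp_alpha : exhibits_CSP (mset_action 'I_n) (sigma dn)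
    (multisubsets_comp k alpha) (genpoly (@msum n) (multisubsets_comp k alpha)).
  apply: exhibits_CSP_nat => [g sg A | omega]; last first.
    by rewrite order_sigma // => pro e; apply: csp_multisubsets_comp.
  rewrite !mem_multisubsets_comp // => /forallP cA; apply/forallP => j.
  by rewrite /= (count_block_sigma _ _ sg).
split=> //; split=> //.
  by apply/fsubsetP => A; rewrite in_multisubsets in_multisubsets_comp => /andP[].
apply: exhibits_CSP_nat => [g sg A | omega]; last first.
  by rewrite order_sigma // => pro e; apply: csp_multisubsets.
rewrite !in_multisubsets => /eqP <-; rewrite !(size_blocks dn).
(* The size is the sum of the block counts, each preserved by the rotation. *)
by apply/eqP/eq_bigr => j _; rewrite /= (count_block_sigma _ _ sg).
Qed.
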